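(* Let $(X,d,\mu)$ be an irreversible metric measure space satisfying $(2,q)$-Moment concentration for $q\ge 1$ with constant $C>0$, i.e. for every $q\ge 1$ and every 1-Lipschitz function $f$ on $X$, $$\left\|f-\int_X f\,d\mu\right\|_{L^q(\mu)}^2\le \frac{q}{C}.$$ Then: (i) $(X,d,\mu)$ satisfies linear tail-decay when $0<r<\sqrt{e/C}$: there is a constant $C_1>0$ such that for every 1-Lipschitz function $f$ and every $0<r<\sqrt{e/C}$, $$\mu\left(\left\{x\in X\;\middle|\;\left|f(x)-\int_X f\,d\mu\right|\ge r\right\}\right)\le \frac{1}{C_1 r};$$ (ii) $(X,d,\mu)$ has normal concentration when $r>\sqrt{e/C}$: there are constants $C_2,c_2>0$ such that $\alpha_{(X,d,\mu)}(r)\le C_2e^{-c_2r^2}$ for every $r>\sqrt{e/C}$.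
   Context: An irreversible metric space $(X,d)$ is a set $X$ with a function $d:X\times X\to[0,\infty)$ such that $d(x_1,x_2)=0$ if and only if $x_1=x_2$, and $d(x_1,x_3)\le d(x_1,x_2)+d(x_2,x_3)$ for all $x_1,x_2,x_3\in X$ ($d$ need not be symmetric). An irreversible metric measure space $(X,d,\mu)$ is an irreversible metric space endowed with a Borel probability measure $\mu$. For $A\subset X$ and $r>0$ put $B^{+}(A,r)=\{x\in X\mid \inf_{z\in A}d(z,x)<r\}$ and $B^{-}(A,r)=\{x\in X\mid \inf_{z\in A}d(x,z)<r\}$. The concentration function is $$\alpha_{(X,d,\mu)}(r)=\sup\left\{1-\min\{\mu(B^{+}(A,r)),\mu(B^{-}(A,r))\}\;\middle|\; A\subset X \text{ Borel},\ \mu(A)\ge \tfrac12\right\},\quad r>0.$$ A function $f:X\to\mathbb{R}$ is $L$-Lipschitz ($L>0$) if $f(z)-f(x)\le L\,d(x,z)$ for all $x,z\in X$. The sets $B^{\pm}(A,r)$ and Lipschitz functions are understood to be measurable. Here $e$ is the base of the natural logarithm. *)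

(* Defs.v *)
From HB Require Import structures.
From mathcomp Require Import all_boot all_order all_algebra.
From mathcomp Require Import all_classical all_reals all_analysis.

Set Implicit Arguments.
Unset Strict Implicit.
Unset Printing Implicit Defensive.

Import Order.TTheory GRing.Theory Num.Theory.
Import numFieldNormedType.Exports.

Local Open Scope classical_set_scope.
Local Open Scope ring_scope.

Notation borel X := (g_sigma_algebraType (@open X)).

Record irreversible_metric (R : realType) (X : Type) (d : X -> X -> R) : Prop :=
  IrreversibleMetric {
    irrev_ge0 : forall x y, 0 <= d x y ;
    irrev_eq0 : forall x y, d x y = 0 <-> x = y ;
    irrev_triangle : forall x y z, d x z <= d x y + d y z }.

(* The infima are taken in [\bar R], so that the infimum over the empty set is
   [+oo] and both neighborhoods of the empty set are empty. *)
Definition fwd_nbhd (R : realType) (X : Type) (d : X -> X -> R)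
    (A : set X) (r : R) : set X :=
  [set x | (ereal_inf [set (d z x)%:E | z in A] < r%:E)%E].

Definition bwd_nbhd (R : realType) (X : Type) (d : X -> X -> R)
    (A : set X) (r : R) : set X :=
  [set x | (ereal_inf [set (d x z)%:E | z in A] < r%:E)%E].

Definition irrev_lipschitz (R : realType) (X : Type) (d : X -> X -> R)
    (L : R) (f : X -> R) : Prop :=
  forall x z, f z - f x <= L * d x z.

(* The standing measurability convention. The topology whose open sets generate
   the Borel sigma-algebra need not be the forward one (or the backward one, or
   their join), provided that the following holds. *)
Record irrev_measurable (R : realType) (X : ptopologicalType)
    (d : X -> X -> R) : Prop := IrrevMeasurable {
  measurable_fwd_nbhd : forall (A : set (borel X)) (r : R),
    measurable A -> 0 < r -> measurable (fwd_nbhd d A r : set (borel X)) ;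
  measurable_bwd_nbhd : forall (A : set (borel X)) (r : R),
    measurable A -> 0 < r -> measurable (bwd_nbhd d A r : set (borel X)) ;
  measurable_irrev_lipschitz : forall (L : R) (f : borel X -> R),
    0 < L -> irrev_lipschitz d L f -> measurable_fun [set: borel X] f }.

Definition concentration_function (R : realType) (X : ptopologicalType)
    (d : X -> X -> R) (mu : probability (borel X) R) (r : R) : \bar R :=
  ereal_sup
    [set (1 - mine (mu (fwd_nbhd d A r)) (mu (bwd_nbhd d A r)))%E
      | A in [set B : set (borel X) | measurable B /\ ((2^-1)%:E <= mu B)%E]].

(* If [f] is measurable but not integrable, the [L^1] distance from [f] to any
   real number is [+oo]: the inequality for [q = 1] thus forces integrability,
   whatever value [Rintegral] takes on nonintegrable functions. *)
Definition moment2_concentration (R : realType) (X : ptopologicalType)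
    (d : X -> X -> R) (mu : probability (borel X) R) (C : R) : Prop :=
  forall (q : R) (f : borel X -> R), 1 <= q -> irrev_lipschitz d 1 f ->
    ('N[mu]_(q%:E)[EFin \o (fun x => f x - Rintegral mu setT f)%R] ^+ 2
       <= (q / C)%:E)%E.

(* Main.v *)
Require Import Defs.
From mathcomp Require Import all_boot all_order all_algebra.
From mathcomp Require Import all_classical all_reals all_analysis.
From mathcomp Require Import measurable_realfun ring lra.

Import Order.TTheory GRing.Theory Num.Theory.
Import numFieldNormedType.Exports.

Local Open Scope classical_set_scope.
Local Open Scope ring_scope.

(* The moment bounds give tails through Markov's inequality: [q = 1] yields the
   linear tail, and optimising over [q] a Gaussian tail. The concentration
   function is controlled by applying these to the distances from [A] and to
   [A], which vanish on [A] and are at least [r] outside of the corresponding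
   neighborhood of [A]. Since [A] has mass at least [1/2], the linear tail
   bounds the mean of these functions by [2 / sqrt C], so for large [r] they
   deviate from their mean by at least [r / 2] outside of the neighborhood. *)

(** Markov's inequality for the nondecreasing map [y |-> y^q]. The product form in [\bar R] needs no
    integrability of [g]: the norm may be [+oo]. *)
Lemma markov_Lnorm (d : measure_display) (T : measurableType d) (R : realType)
    (mu : measure T R) (g : T -> R) (q t : R) :
  0 < q -> 0 < t -> measurable_fun setT g ->
  ((t `^ q)%:E * mu [set x | (t <= `|g x|)%R] <= 'N[mu]_(q%:E)[EFin \o g] `^ q)%E.
Proof.
move=> q0 t0 mg; rewrite poweR_Lnorm ?gt_eqF//.
have := @le_integral_comp_abse _ _ _ mu setT measurableT (EFin \o g) t
  (fun y => y `^ q)%E (measurable_poweR q).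
rewrite setTI poweR_EFin; apply => //.
- by move=> r _; exact: poweR_ge0.
- move=> x y; rewrite !inE/= !in_itv/= !andbT => x0 y0.
  by apply: gt0_ler_poweR; rewrite ?ltW// in_itv/= ?x0 ?y0 leey.
- exact/measurable_EFinP.
Qed.

Lemma measurable_deviation (d : measure_display) (T : measurableType d)
    (R : realType) (f : T -> R) (m t : R) :
  measurable_fun setT f -> measurable [set x | t <= `|f x - m|].
Proof.
move=> mf; rewrite -[X in measurable X]setTI.
rewrite (_ : [set x | _] = (fun x => `|f x - m|) @^-1` `[t, +oo[).
  suff : measurable_fun setT (fun x => `|f x - m|) by exact.
  by apply: measurableT_comp => //; exact: measurable_funB.
by apply/seteqP; split=> x /=; rewrite in_itv/= andbT.
Qed.

Lemma moment2_tail (R : realType) (X : ptopologicalType) (d : X -> X -> R)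
    (mu : probability (borel X) R) (C : R) (f : borel X -> R) (q t : R) :
  irrev_measurable d -> 0 < C -> moment2_concentration d mu C ->
  irrev_lipschitz d 1 f -> 1 <= q -> 0 < t ->
  (mu [set x | (t <= `|f x - Rintegral mu setT f|)%R]
     <= ((q / (C * t ^+ 2)) `^ (q / 2))%:E)%E.
Proof.
move=> dm C0 mom flip q1 t0.
have q0 : 0 < q by exact: lt_le_trans q1.
set g := fun x => f x - Rintegral mu setT f.
have mg : measurable_fun setT g.
  apply: measurable_funB => //.
  exact: (measurable_irrev_lipschitz dm ltr01 flip).
have := @markov_Lnorm _ _ _ mu g q t q0 t0 mg.
have N0 : (0 <= 'N[mu]_(q%:E)[EFin \o g])%E by exact: Lnorm_ge0.
have := mom q f q1 flip; rewrite -/g.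
(* The norm is finite: [+oo] would violate the moment bound, [-oo] nonnegativity. *)
case: ('N[mu]_(q%:E)[EFin \o g])%E N0 => [N| |]//.
rewrite lee_fin => N0; rewrite -EFin_expe lee_fin => Nle.
rewrite poweR_EFin -lee_pdivlMl ?powR_gt0// => /le_trans; apply.
(* The hypothesis bounds the square of the norm, so [q]-th powers become [q / 2]-th powers of
   squares. *)
have pow2 x : 0 <= x -> x `^ q = (x ^+ 2) `^ (q / 2).
  by move=> x0; rewrite -powR_mulrn// -powRrM; congr (_ `^ _); field.
have qC : 0 <= q / (C * t ^+ 2) by rewrite divr_ge0 ?mulr_ge0 ?sqr_ge0// ltW.
rewrite lee_fin ler_pdivrMl ?powR_gt0// (pow2 N)// (pow2 t (ltW t0)).
rewrite -powRM ?sqr_ge0//; apply: ge0_ler_powR; rewrite ?nnegrE ?sqr_ge0//.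
- by rewrite divr_ge0 ?(ltW q0).
- by rewrite mulr_ge0 ?sqr_ge0.
suff -> : t ^+ 2 * (q / (C * t ^+ 2)) = q / C by [].
by field; rewrite !gt_eqF.
Qed.

Lemma moment2_linear_tail (R : realType) (X : ptopologicalType)
    (d : X -> X -> R) (mu : probability (borel X) R) (C : R)
    (f : borel X -> R) (t : R) :
  irrev_measurable d -> 0 < C -> moment2_concentration d mu C ->
  irrev_lipschitz d 1 f -> 0 < t ->
  (mu [set x | (t <= `|f x - Rintegral mu setT f|)%R]
     <= (1 / (Num.sqrt C * t))%:E)%E.
Proof.
move=> dm C0 mom flip t0.
apply: le_trans (moment2_tail _ _ d mu C f 1 t dm C0 mom flip _ t0) _ => //.
have Ct0 : 0 <= C * t ^+ 2 by rewrite mulr_ge0 ?sqr_ge0 ?ltW.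
rewrite lee_fin !div1r powR12_sqrt ?invr_ge0//.
by rewrite sqrtrV// sqrtrM ?(ltW C0)// sqrtr_sqr gtr0_norm.
Qed.

(* The moment bound is optimised by [q = C t^2 / e], which is at least [1]
   precisely when [t >= sqrt (e / C)]. *)
Lemma moment2_gaussian_tail (R : realType) (X : ptopologicalType)
    (d : X -> X -> R) (mu : probability (borel X) R) (C : R)
    (f : borel X -> R) (t : R) :
  irrev_measurable d -> 0 < C -> moment2_concentration d mu C ->
  irrev_lipschitz d 1 f -> Num.sqrt (expR 1 / C) <= t ->
  (mu [set x | (t <= `|f x - Rintegral mu setT f|)%R]
     <= (expR (- (C / (2 * expR 1) * t ^+ 2)))%:E)%E.
Proof.
move=> dm C0 mom flip tge.
have e0 : 0 < expR 1 :> R by exact: expR_gt0.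
have t0 : 0 < t by apply: lt_le_trans tge; rewrite sqrtr_gt0 divr_gt0.
have t2 : expR 1 / C <= t ^+ 2.
  rewrite -[leLHS]sqr_sqrtr; last by rewrite divr_ge0 ?ltW.
  by rewrite lerXn2r ?nnegrE ?sqrtr_ge0 ?(ltW t0).
have q1 : 1 <= C * t ^+ 2 / expR 1.
  by rewrite ler_pdivlMr// mul1r mulrC -ler_pdivrMr.
apply: le_trans (moment2_tail _ _ d mu C f _ t dm C0 mom flip q1 t0) _.
(* With this [q] the base of the power is [1 / e], so the bound reads [expR (- q / 2)]. *)
have -> : C * t ^+ 2 / expR 1 / (C * t ^+ 2) = expR (-1).
  by rewrite expRN; field; rewrite !gt_eqF.
rewrite -expRM lee_fin le_eqVlt; apply/orP; left; apply/eqP.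
by congr expR; field; rewrite gt_eqF.
Qed.

(** On [A] the deviation of [f] from its mean [m] is exactly [|m|], so the linear tail at [t = |m|]
    is at least [1/2]. *)
Lemma moment2_mean_le (R : realType) (X : ptopologicalType)
    (d : X -> X -> R) (mu : probability (borel X) R) (C : R)
    (f : borel X -> R) (A : set (borel X)) :
  irrev_measurable d -> 0 < C -> moment2_concentration d mu C ->
  irrev_lipschitz d 1 f -> measurable A -> ((2^-1)%:E <= mu A)%E ->
  (forall x, A x -> f x = 0) ->
  `|Rintegral mu setT f| <= 2 / Num.sqrt C.
Proof.
move=> dm C0 mom flip mA muA fA.
set m := Rintegral mu setT f.
have s0 : 0 < Num.sqrt C by rewrite sqrtr_gt0.
have [->|m0] := eqVneq m 0; first by rewrite normr0 divr_ge0 ?(ltW s0).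
have am : 0 < `|m| by rewrite normr_gt0.
have mE : measurable [set x | `|m| <= `|f x - m|].
  by apply: measurable_deviation; exact: (measurable_irrev_lipschitz dm ltr01).
have : ((2^-1)%:E <= (1 / (Num.sqrt C * `|m|))%:E)%E.
  apply: le_trans (moment2_linear_tail _ _ d mu C f `|m| dm C0 mom flip am).
  apply: le_trans muA _; apply: le_measure; rewrite ?inE//.
  by move=> x Ax /=; rewrite fA// sub0r normrN.
rewrite lee_fin div1r lef_pV2 ?posrE ?mulr_gt0// => h.
by rewrite ler_pdivlMr// mulrC.
Qed.

(* The factor [expR 2] makes the bound trivial for [r < 4 sqrt (e / C)]; for the
   other values of [r], the mean of [f] is at most [r / 2]. *)
Lemma moment2_enlargement (R : realType) (X : ptopologicalType)
    (d : X -> X -> R) (mu : probability (borel X) R) (C : R)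
    (f : borel X -> R) (A N : set (borel X)) (r : R) :
  irrev_measurable d -> 0 < C -> moment2_concentration d mu C ->
  irrev_lipschitz d 1 f -> measurable A -> ((2^-1)%:E <= mu A)%E ->
  (forall x, A x -> f x = 0) -> measurable N ->
  (forall x, ~ N x -> r <= `|f x|) -> 0 < r ->
  (1 - mu N <= (expR 2 * expR (- (C / (8 * expR 1) * r ^+ 2)))%:E)%E.
Proof.
move=> dm C0 mom flip mA muA fA mN fN r0.
have e0 : 0 < expR 1 :> R by exact: expR_gt0.
have e1 : 1 <= expR 1 :> R by rewrite -expR0 ler_expR.
set s := Num.sqrt (expR 1 / C).
(* As [e >= 1], the bound on the mean is at most [2 * s], hence at most [r / 2] once
   [r >= 4 * s]. *)
have sC : 2 / Num.sqrt C <= 2 * s.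
  rewrite ler_pM2l// /s sqrtrM ?(ltW e0)// sqrtrV ?(ltW C0)//.
  rewrite ler_peMl ?invr_ge0 ?sqrtr_ge0//.
  by rewrite -[leLHS]sqrtr1 ler_wsqrtr.
have s2 : s ^+ 2 = expR 1 / C by rewrite sqr_sqrtr// divr_ge0 ?ltW.
rewrite -probability_setC//.
have [rs|sr] := ltP r (4 * s).
  apply: le_trans (probability_le1 _ (measurableC mN)) _.
  rewrite lee_fin -expRD -[leLHS]expR0 ler_expR subr_ge0.
  (* The exponent [2] is the value of [C r^2 / (8 e)] at [r = 4 * s]. *)
  have -> : 2 = C / (8 * expR 1) * (4 * s) ^+ 2.
    by rewrite exprMn s2; field; rewrite !gt_eqF.
  rewrite ler_pM2l ?divr_gt0 ?mulr_gt0// lerXn2r ?nnegrE ?(ltW r0) ?(ltW rs)//.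
  by rewrite mulr_ge0 ?sqrtr_ge0.
have mle := moment2_mean_le _ _ d mu C f A dm C0 mom flip mA muA fA.
have mE : measurable [set x | r / 2 <= `|f x - Rintegral mu setT f|].
  by apply: measurable_deviation; exact: (measurable_irrev_lipschitz dm ltr01).
have sr2 : s <= r / 2 by have : 0 <= s := sqrtr_ge0 _; lra.
have := moment2_gaussian_tail _ _ d mu C f (r / 2) dm C0 mom flip sr2.
have -> : C / (2 * expR 1) * (r / 2) ^+ 2 = C / (8 * expR 1) * r ^+ 2.
  by field; rewrite gt_eqF.
move=> gtail.
apply: (@le_trans _ _ (expR (- (C / (8 * expR 1) * r ^+ 2)))%:E); last first.
  by rewrite lee_fin ler_peMl ?expR_ge0// -expR0 ler_expR.
apply: le_trans gtail; apply: le_measure; rewrite ?inE//.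
  exact: measurableC.
move=> x /= Nx; have := fN x Nx.
have := lerB_dist (f x) (Rintegral mu setT f).
lra.
Qed.

(** The real [inf] of the empty set is [0], whereas the infimum in [fwd_nbhd] is then [+oo]; hence
    the assumption [A !=set0] in the lemmas below. *)
Definition fwd_dist (R : realType) (X : Type) (d : X -> X -> R) (A : set X)
    (x : X) : R :=
  inf [set d z x | z in A].

Arguments fwd_dist {R X} d A x.

Section FwdDist.
Variables (R : realType) (X : Type) (d : X -> X -> R) (A : set X).
Hypothesis d_metric : irreversible_metric d.

Let fwd_dist_lbound x : lbound [set d z x | z in A] 0.
Proof. by move=> _ [z _ <-]; exact: (irrev_ge0 d_metric). Qed.

Lemma fwd_dist_le x z : A z -> fwd_dist d A x <= d z x.
Proof.
by move=> Az; apply: ge_inf; [exists 0; exact: fwd_dist_lbound|exists z].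
Qed.

Lemma le_fwd_dist x c : A !=set0 -> (forall z, A z -> c <= d z x) ->
  c <= fwd_dist d A x.
Proof.
move=> [a Aa] h; apply: lb_le_inf; first by exists (d a x), a.
by move=> _ [z Az <-]; exact: h.
Qed.

Lemma fwd_dist_ge0 x : A !=set0 -> 0 <= fwd_dist d A x.
Proof. by move=> A0; apply: le_fwd_dist => // z _; exact: irrev_ge0. Qed.

Lemma fwd_dist0 x : A x -> fwd_dist d A x = 0.
Proof.
move=> Ax; apply/eqP; rewrite eq_le fwd_dist_ge0; last by exists x.
by rewrite andbT -[leRHS](proj2 (irrev_eq0 d_metric x x) erefl) fwd_dist_le.
Qed.

(** Take the infimum over [a] in [d a z <= d a x + d x z]: measuring from [A] gives the direction
    that [irrev_lipschitz] asks for. *)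
Lemma fwd_dist_lipschitz : A !=set0 -> irrev_lipschitz d 1 (fwd_dist d A).
Proof.
move=> A0 x z; rewrite mul1r lerBlDl -lerBlDr; apply: le_fwd_dist => // a Aa.
rewrite lerBlDr; apply: le_trans (irrev_triangle d_metric a x z).
exact: fwd_dist_le.
Qed.

Lemma fwd_dist_nbhd r x : A !=set0 -> ~ fwd_nbhd d A r x ->
  r <= fwd_dist d A x.
Proof.
move=> A0 /negP; rewrite -leNgt => /ereal_infP h; apply: le_fwd_dist => // z Az.
by rewrite -lee_fin; apply: h; exists z.
Qed.

End FwdDist.

(** Reversal turns the distance to [A] into a distance from [A], so the lemmas above serve both
    neighborhoods. *)
Lemma irreversible_metric_reverse (R : realType) (X : Type) (d : X -> X -> R) :
  irreversible_metric d -> irreversible_metric (fun x y => d y x).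
Proof.
case=> d0 de dt; split=> // [x y|x y z]; last by rewrite addrC.
by split=> [/de->|->] //; apply/de.
Qed.

Theorem theorem3p8 (R : realType) (X : ptopologicalType) (d : X -> X -> R)
    (mu : probability (borel X) R) (C : R)
    (d_metric : irreversible_metric d) (d_meas : irrev_measurable d)
    (C_gt0 : 0 < C) (mu_moment : moment2_concentration d mu C) :
  (exists C1 : R, 0 < C1 /\
    forall (f : borel X -> R) (r : R), irrev_lipschitz d 1 f ->
      0 < r -> r < Num.sqrt (expR 1 / C) ->
      (mu [set x | (r <= `|f x - Rintegral mu setT f|)%R]
         <= (1 / (C1 * r))%:E)%E) /\
  (exists C2 c2 : R, [/\ 0 < C2, 0 < c2 &
    forall r : R, Num.sqrt (expR 1 / C) < r ->
      (concentration_function d mu r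
         <= (C2 * expR (- (c2 * r ^+ 2)))%:E)%E]).
Proof.
split.
  exists (Num.sqrt C); rewrite sqrtr_gt0; split=> // f r flip r0 _.
  exact: (moment2_linear_tail _ _ d mu C f r).
exists (expR 2), (C / (8 * expR 1)).
rewrite expR_gt0 divr_gt0 ?mulr_gt0 ?expR_gt0//; split=> // r sr.
have r0 : 0 < r by exact: le_lt_trans (sqrtr_ge0 _) sr.
apply: ub_ereal_sup => _ [A [mA muA] <-].
have A0 : A !=set0.
  by apply/set0P/negP => /eqP A0; move: muA; rewrite A0 measure0 lee_fin invr_le0 lern0.
(* The minimum is one of the two masses, and each is bounded on its own. *)
rewrite /mine; case: ifP => _.
- apply: (moment2_enlargement _ _ d mu C (fwd_dist d A) A) => //.
  + exact: fwd_dist_lipschitz.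
  + by move=> x; exact: fwd_dist0.
  + exact: (measurable_fwd_nbhd d_meas).
  + by move=> x Nx; rewrite ger0_norm ?fwd_dist_ge0//; exact: fwd_dist_nbhd.
- have d'_metric := irreversible_metric_reverse R X d d_metric.
  pose f x := fwd_dist (fun x y => d y x) A x.
  (* The distance to [A] is 1-Lipschitz for the reversed metric; changing its sign makes it
     1-Lipschitz for [d] and keeps its absolute value. *)
  apply: (moment2_enlargement _ _ d mu C (fun x => - f x) A) => //.
  + move=> x z; rewrite [leLHS]addrC opprK.
    exact: (fwd_dist_lipschitz _ _ _ _ d'_metric A0 z x).
  + by move=> x Ax; rewrite /f fwd_dist0// oppr0.
  + exact: (measurable_bwd_nbhd d_meas).
  + move=> x Nx; rewrite normrN ger0_norm ?fwd_dist_ge0//.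
    exact: fwd_dist_nbhd.
Qed.
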